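(* Let $m>1$ and let $\langle Z_m\rangle=\langle z_1,\ldots,z_m\rangle$ be the free nonunitary semigroup on $m$ generators. Let $\rho_n=\rho_n(z_1,\ldots,z_m)\in\langle Z_m\rangle$, $n=0,1,2,\ldots$, be a sequence of words with the same abelianization $\bar\rho=\bar z_1^{b_1}\cdots\bar z_m^{b_m}$, such that the polynomial $t^m-f_\rho(t)\in\mathbb{Z}[t]$, where $f_\rho(t)=b_mt^{m-1}+b_{m-1}t^{m-2}+\cdots+b_2t+b_1$, is irreducible over $\mathbb{Q}$ and has a real zero in the interval $(-1,0)$. Let $\omega_0,\omega_1,\ldots,\omega_{m-1}\in\langle Z_m\rangle$ be words with abelianizations $\bar\omega_j=\bar z_1^{a_{1j}}\cdots\bar z_m^{a_{mj}}$, $j=0,1,\ldots,m-1$, such that the $m\times m$ determinant $\det(a_{ij})$ is different from zero. Define $$\omega_{n+m}=\rho_n(\omega_n,\omega_{n+1},\ldots,\omega_{n+m-1}),\quad n=0,1,2,\ldots,$$ let $I(\omega,\rho)$ be the ideal of $\langle Z_m\rangle$ consisting of all words which are not subwords of any word $\omega_n$, $n=0,1,2,\ldots$, and let $S(\omega,\rho)=\langle Z_m\rangle/I(\omega,\rho)$ be the Rees factor semigroup. Then $S(\omega,\rho)$ is not nilpotent, and there exists a degree function $d$ on $\langle Z_m\rangle$ such that $S(\omega,\rho)$ is the union of the subsemigroups $$S(\omega,\rho)_+=\{s\ne0\mid d(s)>0\}\cup\{0\},\qquad S(\omega,\rho)_-=\{s\ne 0\mid d(s)<0\}\cup\{0\}$$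 of $S(\omega,\rho)$, which are locally nilpotent, whose finitely generated ideals are nilpotent, and which satisfy $S(\omega,\rho)_+\cap S(\omega,\rho)_-=\{0\}$.
   Context: The free nonunitary semigroup consists of all nonempty finite words under concatenation. The abelianization of a word $w$ is $\bar w=\bar z_1^{c_1}\cdots\bar z_m^{c_m}$, where $c_i$ is the number of occurrences of $z_i$ in $w$ (that is, $w$ modulo the commutativity relations $z_iz_j=z_jz_i$). The word $\rho_n(\omega_n,\ldots,\omega_{n+m-1})$ is obtained from $\rho_n(z_1,\ldots,z_m)$ by substituting $\omega_{n+i-1}$ for $z_i$, $i=1,\ldots,m$. A subword is a block of consecutive letters. For an ideal $\mathbb{I}$ of $F=\langle Z_m\rangle$, the Rees factor $F/\mathbb{I}$ is $(F\setminus\mathbb{I})\cup\{0\}$ with all elements of $\mathbb{I}$ identified with $0$. A degree function on $\langle Z_m\rangle$ is a map $d:\langle Z_m\rangle\to\mathbb{R}$ with $d(w_1w_2)=d(w_1)+d(w_2)$ for all $w_1,w_2$; it induces a function on the nonzero elements of any Rees factor. A semigroup $T$ with zero is nilpotent if for some $n\ge1$ all products of $n$ elements of $T$ are $0$; it is locally nilpotent if every finitely generated subsemigroup is nilpotent. ''Finitely generated ideals of $S(\omega,\rho)_\pm$'' means ideals of the semigroup $S(\omega,\rho)_\pm$ itself generated by finite subsets. *)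

(* Defs.v *)
From HB Require Import structures.
From mathcomp Require Import all_boot all_order all_algebra.
From mathcomp Require Import all_classical all_reals.

Set Implicit Arguments.
Unset Strict Implicit.
Unset Printing Implicit Defensive.

Import Order.TTheory GRing.Theory Num.Theory.
Local Open Scope classical_set_scope.

HB.mixin Record Semigroup_hasZero G of Semigroup G := {
  sg0 : G;
  mul0g : left_zero sg0 ( *%g : G -> G -> G);
  mulg0 : right_zero sg0 ( *%g : G -> G -> G)
}.

#[short(type="semigroup0Type")]
HB.structure Definition Semigroup0 := {G of Semigroup_hasZero G & Semigroup G}.

Arguments sg0 {_}.

Section Subsets.
Variable G : semigroupType.
Implicit Types T J X : set G.

Definition subsemigroup T := forall x y, T x -> T y -> T (x * y)%g.

(* J is an ideal of the subsemigroup T; the empty set is allowed. *)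
Definition ideal_in T J :=
  J `<=` T /\ forall t x, T t -> J x -> J (t * x)%g /\ J (x * t)%g.

Definition gen_subsemigroup X : set G := smallest subsemigroup X.

Definition gen_ideal T X : set G := smallest (ideal_in T) X.

Structure ideal := Ideal {
  ideal_set :> set G;
  ideal_setP : ideal_in setT ideal_set
}.

End Subsets.

Section Nilpotency.
Variable G : semigroup0Type.
Implicit Types T X : set G.

(* foldl *%g x s is the product of the nonempty sequence x :: s. *)
Definition nilpotent T := exists2 n, (0 < n)%N &
  forall (x : G) (s : seq G), size (x :: s) = n ->
    (forall y, y \in x :: s -> T y) -> foldl *%g x s = sg0.

Definition locally_nilpotent T :=
  forall X, finite_set X -> X `<=` T -> nilpotent (gen_subsemigroup X).

Definition fg_ideals_nilpotent T :=
  forall X, finite_set X -> X `<=` T -> nilpotent (gen_ideal T X).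

End Nilpotency.

Section Rees.
Variables (G : semigroupType) (I : ideal G).

(* None is the zero of the Rees factor. *)
Definition rees := option {x : G | x \notin (I : set G)}.

HB.instance Definition _ :=
  Choice.copy rees (option {x : G | x \notin (I : set G)}).

Definition rees_mul (s t : rees) : rees :=
  if s is Some x then
    if t is Some y then insub (val x * val y)%g else None
  else None.

Lemma rees_mulA : associative rees_mul.
Proof.
have idl (x y : G) : x \in (I : set G) ->
    (x * y)%g \in (I : set G) /\ (y * x)%g \in (I : set G).
  by rewrite !inE => Ix; have [_ /(_ y x Logic.I Ix)[]] := ideal_setP I.
case=> [x|] // [y|]; last by case.
case=> [z|] /=; last by case: insubP.
case: (insubP _ (val y * val z)%g) => [u _ Eu|/negPn yzI];
  case: (insubP _ (val x * val y)%g) => [v _ Ev|/negPn xyI] //=.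
- by rewrite Eu Ev mulgA.
- by rewrite insubN // negbK Eu mulgA; case: (idl _ (val z) xyI).
- by rewrite insubN // negbK Ev -mulgA; case: (idl _ (val x) yzI).
Qed.

HB.instance Definition _ := isSemigroup.Build rees rees_mulA.

Lemma rees_mul0 : left_zero (None : rees) ( *%g : rees -> rees -> rees).
Proof. by []. Qed.

Lemma rees_mulr0 : right_zero (None : rees) ( *%g : rees -> rees -> rees).
Proof. by case. Qed.

HB.instance Definition _ := Semigroup_hasZero.Build rees rees_mul0 rees_mulr0.

End Rees.

Section Degree.
Variables (R : realType) (G : semigroupType).
Implicit Types (d : G -> R) (I : ideal G).

Definition degree_function d := {morph d : u v / (u * v)%g >-> (u + v)%R}.

Definition rees_pos I d : set (rees I) :=
  [set s | if s is Some x then (0 < d (val x))%R : Prop else True].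

Definition rees_neg I d : set (rees I) :=
  [set s | if s is Some x then (d (val x) < 0)%R : Prop else True].

End Degree.

Section FreeSemigroup.
Variable m : nat.

(* The free nonunitary semigroup on z_1, ..., z_m; the letter z_i is the
   ordinal i - 1. *)
Definition free_sg := {w : seq 'I_m | w != [::]}.

HB.instance Definition _ :=
  Choice.copy free_sg {w : seq 'I_m | w != [::]}.

Fact free_sg_mul_subproof (u v : free_sg) : val u ++ val v != [::].
Proof. by case: u => [[]]. Qed.

Definition free_sg_mul (u v : free_sg) : free_sg :=
  exist _ (val u ++ val v) (free_sg_mul_subproof u v).

Fact free_sg_mulA : associative free_sg_mul.
Proof. by move=> u v w; apply: val_inj; rewrite /= catA. Qed.

HB.instance Definition _ := isSemigroup.Build free_sg free_sg_mulA.

(* Abelianizations are represented by their exponent vectors. *)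
Definition abelianization (w : free_sg) : {ffun 'I_m -> nat} :=
  [ffun i => count_mem i (val w)].

Fact subst_subproof (r : free_sg) (s : 'I_m -> free_sg) :
  flatten [seq val (s i) | i <- val r] != [::].
Proof. by case: r => [[|i r] //= _]; case: (s i) => [[]]. Qed.

(* The word r(s_1, ..., s_m). *)
Definition subst_word (r : free_sg) (s : 'I_m -> free_sg) : free_sg :=
  exist _ (flatten [seq val (s i) | i <- val r]) (subst_subproof r s).

Definition subword (u w : free_sg) : bool := infix (val u) (val w).

Definition nonsubwords (om : nat -> free_sg) : set free_sg :=
  [set u | forall n, ~~ subword u (om n)].

Fact nonsubwords_ideal om : ideal_in setT (nonsubwords om).
Proof.
split=> // t x _ Ix; split=> n; apply: contra (Ix n);
  apply: infix_trans.
- exact: infix_catl (infix_refl _).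
- exact: infix_catr (infix_refl _).
Qed.

Definition nonsubword_ideal om := Ideal (nonsubwords_ideal om).

End FreeSemigroup.

(* t^m - (b_m t^(m-1) + ... + b_2 t + b_1). *)
Definition char_poly_rho (m : nat) (b : {ffun 'I_m -> nat}) : {poly int} :=
  ('X^m - \sum_(i < m) (b i)%:R *: 'X^i)%R.

(* Main.v *)
(* Let x be the root in (-1, 0).  As det (a_ij) != 0, the letters can be given
   weights for which deg (om j) = x^j for j < m; the recurrence and
   x^m = f_rho(x) extend this to deg (om n) = x^n for all n.  The degree of a
   word is a nonzero rational combination of 1, x, .., x^(m-1), so it does not
   vanish, by irreducibility.  A prefix of om (n + m) is a product of a bounded
   number of words om (n + i) followed by a prefix of one of them, so the
   degrees of prefixes exceed those of the first m words by at most a geometric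
   series in |x|; hence degrees of subwords are bounded.  In the positive part,
   the elements of degree at least e > 0 form (with 0) an ideal which is
   nilpotent by this bound, and the negative part is the positive part for -deg.
   Finally the degrees x^n are pairwise distinct, so the words om n have
   unbounded lengths and the Rees factor is not nilpotent. *)
Require Import Defs.
From mathcomp Require Import all_boot all_order all_algebra.
From mathcomp Require Import all_classical all_reals.

Import Order.TTheory GRing.Theory Num.Theory.
Local Open Scope classical_set_scope.
Local Open Scope ring_scope.

Set Implicit Arguments.
Unset Strict Implicit.
Unset Printing Implicit Defensive.

(** * Roots of irreducible polynomials, and projection onto a Rees factor *)

Lemma irreducible_map_rootN (F K : fieldType) (f : {rmorphism F -> K})
    (p q : {poly F}) (x : K) :
  irreducible_poly p -> root (map_poly f p) x ->
  q != 0 -> (size q < size p)%N -> ~~ root (map_poly f q) x.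
Proof.
move=> p_irr px q0 ltqp; apply: coprimep_root px.
(* Coprimality survives the field extension and excludes a common root; [p] cannot divide [q], which
   is nonzero and of smaller degree. *)
rewrite coprimep_map irreducible_poly_coprime //.
by apply: contraL ltqp => /(dvdp_leq q0); rewrite -leqNgt.
Qed.

(** Here [insub] acts as the canonical projection, sending the elements of [I] to the zero
    [None]. *)
Lemma rees_proj_mul (G : semigroupType) (I : ideal G) (x y : G) :
  (insub (x * y)%g : rees I) = ((insub x : rees I) * insub y)%g.
Proof.
have [_ idl] := ideal_setP I.
case: (insubP {x : G | x \notin (I : set G)} y) => [v _ <-|/negPn]; last first.
  rewrite inE => /(idl x _ Logic.I)[Ixy _].
  by rewrite [RHS]mulg0 insubN // negbK inE.
case: (insubP {x : G | x \notin (I : set G)} x) => [u _ <-|/negPn] //.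
rewrite inE => /(idl (val v) _ Logic.I)[_ Ixy].
by rewrite [RHS]mul0g insubN // negbK inE.
Qed.

Lemma rees_proj_foldl (G : semigroupType) (I : ideal G) (x : G) (s : seq G) :
  foldl *%g (insub x : rees I) (map insub s) = insub (foldl *%g x s).
Proof. by elim: s x => //= y s IHs x; rewrite -rees_proj_mul IHs. Qed.

(** * Nilpotency in the positive part under an upper bound on degrees *)

Section PositivePart.
Variables (R : realType) (G : semigroupType) (I : ideal G) (d : G -> R).
Hypothesis dM : degree_function d.
Implicit Types (T X : set (rees I)) (e C : R).

Definition rees_ge e : set (rees I) :=
  [set s | if s is Some x then (e <= d (val x) : Prop) else True].

Lemma rees_mulP (s t : rees I) :
  (s * t)%g = None \/
  exists x y z, [/\ s = Some x, t = Some y, (s * t)%g = Some z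
                  & d (val z) = d (val x) + d (val y)].
Proof.
case: s t => [x|] [y|]; try by left.
have -> : ((Some x : rees I) * (Some y : rees I))%g =
  insub (val x * val y)%g :> rees I by [].
case: (insubP {x : G | x \notin (I : set G)} (val x * val y)%g) => [z _ Ez|_];
  last by left.
by right; exists x, y, z; split=> //; rewrite Ez dM.
Qed.

Lemma subsemigroup_rees_pos : subsemigroup (@rees_pos R G I d).
Proof.
move=> s t s0 t0; have [->//|[x [y [z [Es Et -> Ez]]]]] := rees_mulP s t.
by move: s0 t0; rewrite /rees_pos Es Et /= Ez; apply: addr_gt0.
Qed.

Lemma subsemigroup_rees_ge e : 0 <= e -> subsemigroup (rees_ge e).
Proof.
move=> e0 s t; have [->//|[x [y [z [-> -> -> Ez]]]]] := rees_mulP s t.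
by rewrite /rees_ge /= Ez => xe ye; rewrite -[e]addr0 lerD // (le_trans e0).
Qed.

Lemma ideal_rees_ge e :
  ideal_in (@rees_pos R G I d) (@rees_pos R G I d `&` rees_ge e).
Proof.
split=> [s []//|t s t0 [s0 se]].
have M := subsemigroup_rees_pos; split; split; try exact: M.
- have [->//|[x [y [z [Et Es -> Ez]]]]] := rees_mulP t s.
  move: t0 se; rewrite /rees_pos /rees_ge Et Es /= Ez => x0 ye.
  by rewrite -[e]add0r lerD // ltW.
- have [->//|[x [y [z [Es Et -> Ez]]]]] := rees_mulP s t.
  move: t0 se; rewrite /rees_pos /rees_ge Et Es /= Ez => x0 ye.
  by rewrite -[e]addr0 lerD // ltW.
Qed.

(** The witness is the minimum of 1 and the degrees of the nonzero elements of [X]. *)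
Lemma finite_rees_pos_ge X : finite_set X -> X `<=` @rees_pos R G I d ->
  exists2 e, 0 < e & X `<=` rees_ge e.
Proof.
move=> /finite_seqP[s ->{X}]; elim: s => [_|[x|] s IHs sub].
- by exists 1.
- have [|e e0 es] := IHs.
    by move=> t st; apply: sub; rewrite /= inE (st : _ \in _) orbT.
  have x0 : 0 < d (val x) by apply: (sub (Some x)); rewrite /= inE eqxx.
  exists (Num.min e (d (val x))) => [|t /=]; first by rewrite lt_min e0.
  rewrite inE => /predU1P[->|/es]; rewrite /rees_ge /=.
    by rewrite ge_min lexx orbT.
  by case: t => // y; rewrite ge_min => ->.
- have [|e e0 es] := IHs.
    by move=> t st; apply: sub; rewrite /= inE (st : _ \in _) orbT.
  by exists e => // t /=; rewrite inE => /predU1P[->|/es].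
Qed.

(** A nonzero product of [k] elements of [T] has degree at least [e *+ k], which exceeds [C] for
    large [k]. *)
Lemma nilpotent_rees_ge C e T : (forall x, x \notin (I : set G) -> d x <= C) ->
  0 < e -> T `<=` rees_ge e -> nilpotent T.
Proof.
move=> leC e0 Te.
have prod_ge (x : rees I) s : (forall y, y \in x :: s -> T y) ->
    rees_ge (e *+ size (x :: s)) (foldl *%g x s).
  elim/last_ind: s => [|s y IHs] Txs /=.
    by apply: Te; apply: Txs; rewrite mem_head.
  rewrite foldl_rcons size_rcons.
  have /Te ye : T y by apply: Txs; rewrite inE mem_rcons mem_head orbT.
  have := IHs _; set t := foldl _ _ _ => te.
  have {}te : rees_ge (e *+ (size s).+1) t.
    apply: te => z zs; apply: Txs; move: zs.
    by rewrite !inE mem_rcons inE orbCA => ->; rewrite orbT.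
  have [->//|[u [v [w [Et Ey -> Ew]]]]] := rees_mulP t y.
  by move: te ye; rewrite /rees_ge Et Ey /= Ew [e *+ _.+2]mulrSr; apply: lerD.
have [n ltCn] : exists n, C < e *+ n.
  have [n] : exists n, `|C| / e < n%:R.
    exists (Num.bound (`|C| / e)); apply: archi_boundP.
    exact: divr_ge0 (normr_ge0 _) (ltW e0).
  rewrite ltr_pdivrMr // => ltn; exists n; rewrite -mulr_natl.
  exact: le_lt_trans (ler_norm _) ltn.
(* Taking [n.+1] makes positivity of the exponent immediate; the extra factor only raises the
   degree. *)
exists n.+1 => // x s szs /prod_ge; rewrite szs mulrSr.
case: (foldl _ _ _) => [y|//] /le_trans/(_ (leC _ (valP y))).
by rewrite leNgt ltr_wpDr // ltW.
Qed.

Lemma locally_nilpotent_rees_pos C :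
  (forall x, x \notin (I : set G) -> d x <= C) ->
  locally_nilpotent (@rees_pos R G I d).
Proof.
move=> leC X Xfin /(finite_rees_pos_ge Xfin)[e e0 Xe].
apply: (nilpotent_rees_ge leC e0); apply: smallest_sub => //.
exact/subsemigroup_rees_ge/ltW.
Qed.

Lemma fg_ideals_nilpotent_rees_pos C :
  (forall x, x \notin (I : set G) -> d x <= C) ->
  fg_ideals_nilpotent (@rees_pos R G I d).
Proof.
move=> leC X Xfin Xpos; have [e e0 Xe] := finite_rees_pos_ge Xfin Xpos.
apply: (nilpotent_rees_ge leC e0).
apply: subset_trans (@subIsetr _ (@rees_pos R G I d) _).
apply: smallest_sub; first exact: ideal_rees_ge.
by rewrite subsetI.
Qed.

End PositivePart.

Lemma rees_negE (R : realType) (G : semigroupType) (I : ideal G) (d : G -> R) :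
  rees_neg d = rees_pos (- d) :> set (rees I).
Proof.
by apply/funext=> -[x|] //; rewrite /rees_neg /rees_pos /= oppr_gt0.
Qed.

(** * Degrees of words from letter weights *)

Section WordDegree.
Variables (V : nmodType) (T : eqType) (v : T -> V).

Definition word_degree (w : seq T) : V := \sum_(i <- w) v i.

Lemma word_degree_cat u w : word_degree (u ++ w) = word_degree u + word_degree w.
Proof. exact: big_cat. Qed.

Lemma word_degree_flatten (J : Type) (s : J -> seq T) (r : seq J) :
  word_degree (flatten (map s r)) = \sum_(j <- r) word_degree (s j).
Proof. by rewrite /word_degree big_flatten big_map. Qed.

End WordDegree.

(** Makes the degree of a word a function of its abelianization. *)
Lemma sum_count_mem (V : nmodType) (T : finType) (v : T -> V) (s : seq T) :
  \sum_(i <- s) v i = \sum_i v i *+ count_mem i s.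
Proof.
elim: s => [|j s IHs]; first by rewrite big_nil big1.
rewrite big_cons IHs (bigD1 j) //= [in RHS](bigD1 j) //= eqxx addrA -mulrS.
by congr (_ + _); apply: eq_bigr => i /negPf ij; rewrite eq_sym ij.
Qed.

Lemma prefix_catP (T : eqType) (p s t : seq T) : prefix p (s ++ t) ->
  prefix p s \/ exists2 q, p = s ++ q & prefix q t.
Proof.
elim: s p => [|x s IHs] p; first by right; exists p.
case: p => [|y p] /=; first by left.
case: eqP => // -> /IHs[sp|[q -> tq]]; first by left.
by right; exists q.
Qed.

(** * Uniform bounds for degrees of prefixes and subwords *)

Section PrefixBound.
Variables (R : realFieldType) (T : eqType) (v : T -> R).
Local Notation deg := (word_degree v).

(** A prefix of a concatenation consists of at most [size r] whole blocks, each contributing at most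
    [e], and a prefix of one more block, contributing at most [c]. *)
Lemma norm_prefix_flatten (J : Type) (s : J -> seq T) (e c : R) (r : seq J) :
    0 <= c -> (forall j, `|deg (s j)| <= e) ->
    (forall j p, prefix p (s j) -> `|deg p| <= c) ->
  forall p, prefix p (flatten (map s r)) -> `|deg p| <= e *+ size r + c.
Proof.
move=> c0 se sc; elim: r => [p|j r IHr p] /=.
  by case: p => // _; rewrite mulr0n add0r /word_degree big_nil normr0.
have e0 : 0 <= e := le_trans (normr_ge0 _) (se j).
move=> /prefix_catP[/sc pc|[q -> /IHr qr]].
  by rewrite (le_trans pc) // lerDr mulrn_wge0.
rewrite word_degree_cat mulrS -addrA (le_trans (ler_normD _ _)) //.
exact: lerD.
Qed.

Lemma norm_prefix_le_sum (s p : seq T) :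
  prefix p s -> `|deg p| <= \sum_(i <- s) `|v i|.
Proof.
move=> /prefixP[t ->]; rewrite big_cat (le_trans (ler_norm_sum _ _ _)) //=.
by rewrite lerDl sumr_ge0.
Qed.

Lemma sum_geometric_le (a : R) n : 0 <= a < 1 ->
  \sum_(i < n) a ^+ i <= (1 - a)^-1.
Proof.
move=> /andP[a0 a1]; have b0 : 0 < 1 - a by rewrite subr_gt0.
rewrite -(ler_pM2l b0) divff ?gt_eqF // -opprB mulNr -subrX1 opprB.
by rewrite lerBlDr lerDl exprn_ge0.
Qed.

End PrefixBound.

Lemma norm_prefix_bounded (R : realFieldType) (m l : nat) (v : 'I_m -> R)
    (a : R) (rho om : nat -> free_sg m) :
    0 <= a < 1 -> (forall n, size (val (rho n)) = l) ->
    (forall n, om (n + m)%N = subst_word (rho n) (fun i => om (n + i)%N)) ->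
    (forall n, `|word_degree v (val (om n))| <= a ^+ n) ->
  exists c, forall n p, prefix p (val (om n)) -> `|word_degree v p| <= c.
Proof.
move=> a01 rhol omE omle; have /andP[a0 a1] := a01.
pose c0 : R := \sum_(n < m) \sum_(i <- val (om n)) `|v i|.
have c0_ge0 : 0 <= c0 by do 2![apply: sumr_ge0 => *].
(* [c k] will bound the prefixes of [om n] for [n < k + m]: [c0] covers the first [m] words, and
   [om (k + m)], made of [l] blocks of degree at most [a ^+ k] in norm, adds [a ^+ k *+ l]. *)
pose c k : R := c0 + (\sum_(i < k) a ^+ i) *+ l.
have c_ge0 k : 0 <= c k.
  by rewrite addr_ge0 // mulrn_wge0 // sumr_ge0 // => i _; apply: exprn_ge0.
have cS k : c k.+1 = a ^+ k *+ l + c k.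
  by rewrite /c big_ord_recr mulrnDl addrA addrC.
have le_c k n p : (n < k + m)%N -> prefix p (val (om n)) ->
    `|word_degree v p| <= c k.
  elim: k n p => [|k IHk] n p.
    rewrite add0n => ltnm /(norm_prefix_le_sum v)/le_trans; apply.
    rewrite /c big_ord0 mul0rn addr0 /c0 (bigD1 (Ordinal ltnm)) //= lerDl.
    by do 2![apply: sumr_ge0 => *].
  rewrite addSn ltnS leq_eqVlt => /predU1P[->|ltn /(IHk _ _ ltn) le_ck]; last first.
    by rewrite (le_trans le_ck) // cS lerDr mulrn_wge0 ?exprn_ge0.
  rewrite omE /= cS -(rhol k); apply: norm_prefix_flatten => //.
    move=> i; rewrite (le_trans (omle _)) // exprD ler_piMr ?exprn_ge0 //.
    by rewrite exprn_ile1 // ltW.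
  by move=> i q; apply: IHk; rewrite ltn_add2l.
exists (c0 + (1 - a)^-1 *+ l) => n p pn.
apply: le_trans (le_c n.+1 n p _ pn) _; first by rewrite addSn ltnS leq_addr.
by rewrite lerD2l lerMn2r sum_geometric_le ?orbT.
Qed.

(** The degree of a subword is the difference of the degrees of two prefixes. *)
Lemma norm_infix_bounded (R : numDomainType) (T : eqType) (v : T -> R) (c : R)
    (s u : seq T) :
    (forall p, prefix p s -> `|word_degree v p| <= c) ->
  infix u s -> `|word_degree v u| <= c + c.
Proof.
move=> sc /infixP[p [q Es]].
have -> : word_degree v u = word_degree v (p ++ u) - word_degree v p.
  by rewrite word_degree_cat addrAC subrr add0r.
rewrite (le_trans (ler_normB _ _)) // lerD // sc // Es ?prefix_prefix //.
by rewrite catA prefix_prefix.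
Qed.

(** * Long words and failure of nilpotency *)

Lemma size_abelianization (m : nat) (u : free_sg m) :
  size (val u) = (\sum_i abelianization u i)%N.
Proof.
rewrite -sum1_size (sum_count_mem (fun=> 1%N)).
by apply: eq_bigr => i _; rewrite ffunE natn.
Qed.

(** Pigeonhole: only finitely many words over [m] letters have length at most [k]. *)
Lemma infinite_range_size_ge (m : nat) (om : nat -> free_sg m) (k : nat) :
  injective om -> exists n, (k <= size (val (om n)))%N.
Proof.
move=> om_inj; apply: contrapT => no.
have small n : (size (val (om n)) <= k)%N.
  by rewrite ltnW // ltnNge; apply/negP => le_k; apply: no; exists n.
pose f (n : 'I_#|{bseq k of 'I_m}|.+1) : {bseq k of 'I_m} := Bseq (small n).
have /leq_card : injective f.
  by move=> i j [/val_inj/om_inj/val_inj].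
by rewrite card_ord ltnn.
Qed.

Definition letter (m : nat) (i : 'I_m) : free_sg m := exist _ [:: i] isT.

Lemma foldl_letter (m : nat) (u : free_sg m) (s : seq 'I_m) :
  val (foldl *%g u (map (@letter m) s)) = val u ++ s.
Proof.
elim: s u => [|i s IHs] u /=; first by rewrite cats0.
by rewrite IHs /= -catA.
Qed.

(** The first [k] letters of a long enough [om n] multiply to a subword of it, hence to a nonzero
    element. *)
Lemma not_nilpotent_nonsubword (m : nat) (om : nat -> free_sg m) :
  injective om -> ~ nilpotent [set: rees (nonsubword_ideal om)].
Proof.
move=> om_inj [k k0 nil_k]; have [n] := infinite_range_size_ge k om_inj.
case E: (take k (val (om n))) => [|i s] le_k; have := size_takel le_k; rewrite E.
  by move=> k_eq0; rewrite -k_eq0 in k0.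
move=> szs; pose pi := insub : free_sg m -> rees (nonsubword_ideal om).
have := nil_k (pi (letter i)) (map pi (map (@letter m) s)).
rewrite rees_proj_foldl /= !size_map => /(_ szs (fun _ _ => Logic.I)).
rewrite /sg0 /= insubT //.
apply/negP; rewrite inE => /(_ n)/negP; apply.
by rewrite /subword foldl_letter /= -E prefixW ?prefix_take.
Qed.

(** * Linear independence of powers of the root, and the characteristic polynomial *)

Lemma irreducible_row_powers (F K : fieldType) (f : {rmorphism F -> K}) (m : nat)
    (p : {poly F}) (x : K) (u : 'cV[F]_m) :
    irreducible_poly p -> (m < size p)%N -> root (map_poly f p) x ->
  u != 0 -> (\row_(j < m) x ^+ j) *m map_mx f u != 0.
Proof.
(* The entries of [u] are the coefficients of [q], so the matrix product is the value of [q] at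
   [x]. *)
move=> p_irr ltmp px u0; pose q := rVpoly u^T.
have q0 : q != 0.
  apply: contra_neq u0 => q0; apply: trmx_inj.
  by rewrite trmx0 -[LHS]rVpolyK -/q q0 linear0.
have lt_q : (size q < size p)%N by apply: leq_ltn_trans (size_poly _ _) _.
apply: contra (irreducible_map_rootN p_irr px q0 lt_q) => /eqP/matrixP/(_ 0 0).
rewrite !mxE /root => sum0; rewrite map_rVpoly horner_poly.
apply/eqP; rewrite -[RHS]sum0; apply: eq_bigr => j _; rewrite valK !mxE.
exact: mulrC.
Qed.

Lemma abelianization_neq0 (m : nat) (u : free_sg m) :
  \col_i (abelianization u i)%:R != 0 :> 'cV[rat]_m.
Proof.
case: u => -[|i s] // u0; apply/eqP => /colP/(_ i)/eqP.
by rewrite !mxE ffunE /= eqxx pnatr_eq0.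
Qed.

Lemma word_degree_abelianization (V : pzRingType) (m : nat) (v : 'rV[V]_m)
    (u : free_sg m) :
  word_degree (v 0) (val u) = (v *m \col_i (abelianization u i)%:R) 0 0.
Proof.
rewrite /word_degree sum_count_mem mxE; apply: eq_bigr => i _.
by rewrite mxE ffunE mulr_natr.
Qed.

Lemma size_char_poly_rho (m : nat) (b : {ffun 'I_m -> nat}) :
  size (map_poly intr (char_poly_rho b) : {poly rat}) = m.+1.
Proof.
rewrite size_map_inj_poly //; last exact: intr_inj.
rewrite /char_poly_rho size_polyDl size_polyXn // size_polyN ltnS.
rewrite (leq_trans (size_sum _ _ _)) //; apply/bigmax_leqP => i _.
by rewrite (leq_trans (size_scale_leq _ _)) // size_polyXn.
Qed.

Lemma root_char_poly_rho (R : comNzRingType) (m : nat)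
    (b : {ffun 'I_m -> nat}) (x : R) :
  root (map_poly intr (char_poly_rho b)) x -> x ^+ m = \sum_(i < m) x ^+ i *+ b i.
Proof.
rewrite /root /char_poly_rho rmorphB /= map_polyXn hornerD hornerN hornerXn.
rewrite subr_eq0 => /eqP->; rewrite rmorph_sum horner_sum; apply: eq_bigr => i _.
by rewrite /= map_polyZ map_polyXn hornerZ hornerXn /= rmorph_nat mulr_natl.
Qed.

(** * Choice of the degree function and its consequences *)

Theorem theorem7 (R : realType) (m : nat) (hm : (1 < m)%N)
  (rho : nat -> free_sg m) (b : {ffun 'I_m -> nat})
  (hrho : forall n, abelianization (rho n) = b)
  (hirr : irreducible_poly (map_poly intr (char_poly_rho b) : {poly rat}))
  (hroot : exists2 x : R, -1 < x < 0 & root (map_poly intr (char_poly_rho b)) x)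
  (om : nat -> free_sg m)
  (hdet : \det (\matrix_(i < m, j < m) (abelianization (om j) i)%:Z) != 0)
  (hom : forall n, om (n + m)%N = subst_word (rho n) (fun i => om (n + i)%N)) :
  let I := nonsubword_ideal om in
  ~ nilpotent [set: rees I] /\
  exists d : free_sg m -> R,
    let Spos := @rees_pos R (free_sg m) I d in
    let Sneg := @rees_neg R (free_sg m) I d in
    degree_function d /\
    subsemigroup Spos /\ subsemigroup Sneg /\
    [set: rees I] = Spos `|` Sneg /\
    locally_nilpotent Spos /\ locally_nilpotent Sneg /\
    fg_ideals_nilpotent Spos /\ fg_ideals_nilpotent Sneg /\
    Spos `&` Sneg = [set sg0].
Proof.
have [x /andP[x_gt x_lt] px] := hroot.
set M := \matrix_(_, _) _ in hdet.
pose A : 'M[rat]_m := map_mx intr M.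
have A_unit : A \in unitmx by rewrite unitmxE det_map_mx unitfE intr_eq0.
(* Column [j] of [A] is the abelianization of [om j], so [v] solves [v A = (1, x, ..., x^(m-1))],
   with [A] read over [R]. *)
pose v : 'rV[R]_m := (\row_j x ^+ j) *m map_mx ratr (invmx A).
pose deg := word_degree (v 0).
pose ab u : 'cV[rat]_m := \col_i (abelianization u i)%:R.
have degE (u : free_sg m) :
    deg (val u) = ((\row_j x ^+ j) *m map_mx ratr (invmx A *m ab u)) 0 0.
  rewrite /deg word_degree_abelianization map_mxM mulmxA.
  by congr ((_ *m _) 0 0); apply/colP => i; rewrite !mxE rmorph_nat.
(* Since [A] is invertible and [u] is nonempty, [invmx A *m ab u] is a nonzero rational column,
   which the powers of [x] cannot annihilate. *)
have deg_neq0 (u : free_sg m) : deg (val u) != 0.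

  rewrite degE; set B := _ *m _.
  have : B != 0.
    apply: irreducible_row_powers hirr _ _ _; first by rewrite size_char_poly_rho.
      rewrite -map_poly_comp (eq_map_poly (g := intr)) // => k /=.
      exact: ratr_int.
    apply: contra_neq (abelianization_neq0 u) => /(congr1 (mulmx A)).
    by rewrite mulmxA mulmxV // mul1mx mulmx0.
  by apply: contra_neq => B0; apply/matrixP => i j; rewrite !ord1 B0 mxE.
have deg_om n : deg (val (om n)) = x ^+ n.
  elim/ltn_ind: n => n IHn; have [lt_nm|le_mn] := ltnP n m.
    rewrite degE; have -> : ab (om n) = A *m delta_mx (Ordinal lt_nm) 0.
      by rewrite -colE; apply/colP => i; rewrite !mxE.
    by rewrite mulKmx // map_delta_mx -colE !mxE.
  (* The word [rho k] enters only through its abelianization [b], so the claim reduces to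
     [x^k x^m = x^k f_rho(x)]. *)
  rewrite -(subnK le_mn); set k := (n - m)%N.
  rewrite hom /deg word_degree_flatten sum_count_mem exprD (root_char_poly_rho px).
  rewrite mulr_sumr; apply: eq_bigr => i _.
  rewrite -/deg IHn; last by rewrite -[ltnRHS](subnK le_mn) ltn_add2l.
  by rewrite exprD mulrnAr -(hrho k) ffunE.
(* Equal words have equal degrees, and the powers of [|x|] are distinct because [0 < |x| < 1]. *)
have om_inj : injective om.
  move=> i j /(congr1 (deg \o val)); rewrite /= !deg_om => /(congr1 Num.norm).
  rewrite !normrX; apply: ieexprIn; first by rewrite normr_gt0 lt_eqF.
  by rewrite lt_eqF // ltr_norml x_gt (lt_trans x_lt).
have [c le_c] : exists c : R, forall u, u \notin (nonsubword_ideal om : set _) ->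
    `|deg (val u)| <= c.
  have [] := @norm_prefix_bounded R m (\sum_i b i)%N (v 0) `|x| rho om.
  - by rewrite normr_ge0 ltr_norml x_gt (lt_trans x_lt).
  - by move=> n; rewrite size_abelianization hrho.
  - exact: hom.
  - by move=> n; rewrite -/deg deg_om normrX.
  move=> c le_c; exists (c + c) => u.
  rewrite notin_setE => /existsNP[n /negP]; rewrite negbK.
  exact: (norm_infix_bounded (le_c n)).
move=> I; split; first exact: not_nilpotent_nonsubword.
pose d (u : free_sg m) := deg (val u).
have dM : degree_function d by move=> u w; exact: word_degree_cat.
have dNM : degree_function (- d).
  by move=> u w; rewrite !fctE dM opprD.
have le_d u : u \notin (I : set _) -> d u <= c.
  by move=> /le_c; apply: le_trans (ler_norm _).
have le_dN u : u \notin (I : set _) -> (- d) u <= c.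
  by move=> /le_c; apply: le_trans; rewrite -normrN ler_norm.
exists d => Spos Sneg.
have SnegE : Sneg = rees_pos (- d) := rees_negE I d.
split=> //; split; first exact: subsemigroup_rees_pos.
split; first by rewrite SnegE; exact: subsemigroup_rees_pos.
split.
  apply/seteqP; split=> // -[u|] _ /=; last by left.
  by have := deg_neq0 (val u); rewrite neq_lt => /orP[]; [right|left].
split; first exact: locally_nilpotent_rees_pos le_d.
split; first by rewrite SnegE; exact: locally_nilpotent_rees_pos le_dN.
split; first exact: fg_ideals_nilpotent_rees_pos le_d.
split; first by rewrite SnegE; exact: fg_ideals_nilpotent_rees_pos le_dN.
apply/seteqP; split=> -[u|] //= [].
by rewrite /Spos /Sneg /rees_pos /rees_neg /= => /lt_trans/[apply]; rewrite ltxx.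
Qed.
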